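(* (a) Let $S$ be a compact, connected, non-positively curved special cube complex, $\Gamma$ its fundamental group, and $X$ its universal covering, on which $\Gamma$ acts by deck transformations. Then $X$ admits a $\Gamma$-invariant admissible edge labeling. (b) Conversely, let $X$ be a locally finite CAT(0) cube complex and let $\Gamma$ be a subgroup of the group $\mathrm{Aut}(X)$ of cubical automorphisms of $X$ which acts cocompactly on $X$ and for which there exists a $\Gamma$-invariant admissible edge labeling on $X$. Then the quotient $X/\Gamma$ is a compact, non-positively curved special cube complex, $\Gamma$ acts freely on $X$, and $X$ is the universal covering of $X/\Gamma$.
   Context: Special cube complex (Haglund--Wise): a non-positively curved cube complex such that (i) no hyperplane crosses itself; (ii) every hyperplane is two-sided, i.e. its dual edges can be oriented consistently with the parallelism generated by opposite sides of squares (no oriented edge is parallel to its own reverse); (iii) no hyperplane directly self-osculates, i.e. there are no two distinct parallel oriented edges with the same initial vertex which do not form the corner of a square at that vertex; (iv) no two hyperplanes inter-osculate, i.e. there are no two distinct hyperplanes which cross and which also have dual edges sharing a vertex $v$ without forming the corner of a square at $v$. For a CAT(0) cube complex $X$: $X^{(0)}$ is the vertex set, $\vec{\mathcal E}(X)$ the set of oriented edges, $\vec{\mathcal E}(X)_v$ the set of oriented edges starting at the vertex $v$. For an oriented edge $e$ from $v$ to $w$, $h(e)$ denotes the halfspace bounded by the hyperplane dual to $e$ that contains $w$ but not $v$; oriented edges $e,e'$ are parallel if $h(e)=h(e')$. Two edges with exactly one common endpoint span a square if their dual hyperplanes are distinct and intersect (equivalently, they are two sides of a common square). Admissible edge labeling: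 a map $\ell:\vec{\mathcal E}(X)\to\Sigma_0$, where $\Sigma_0$ is a finite set with a fixpoint-free involution $s\mapsto s^{-1}$, such that (A1) parallel oriented edges have the same label, and if $e'$ is $e$ with reversed orientation then $\ell(e')=\ell(e)^{-1}$; (A2) $\ell|_{\vec{\mathcal E}(X)_v}$ is injective for every vertex $v$; (A3) for all vertices $v,w$, all $e_1,e_2\in\vec{\mathcal E}(X)_v$ and $e_1',e_2'\in\vec{\mathcal E}(X)_w$ with $\ell(e_1)=\ell(e_1')$ and $\ell(e_2)=\ell(e_2')$: $e_1,e_2$ span a square if and only if $e_1',e_2'$ span a square. It is $\Gamma$-invariant if $\ell(g(e))=\ell(e)$ for all $g\in\Gamma$, $e\in\vec{\mathcal E}(X)$. *)

(* Defs.v *)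
From Stdlib Require List.
From Stdlib Require Import Relation_Operators.
From mathcomp Require Import all_boot.
From mathcomp Require Import boolp classical_sets cardinality.

Set Implicit Arguments.
Unset Strict Implicit.
Unset Printing Implicit Defensive.

Local Open Scope classical_set_scope.

(* An isometric embedding of the cube [0,1]^m onto a face of the cube [0,1]^n:
   the origin goes to the vertex [fbase], and moving along the coordinate axis
   [i] of the source is moving, away from [fbase], along the axis [fdir i]. *)
Record face (m n : nat) := Face {
  fdir : {ffun 'I_m -> 'I_n};
  fbase : {ffun 'I_n -> bool};
  fdir_inj : injectiveb fdir }.

Definition fvertex m n (f : face m n) (x : {ffun 'I_m -> bool}) :
    {ffun 'I_n -> bool} :=
  [ffun j => fbase f j (+) [exists i, (fdir f i == j) && x i]].

Lemma fid_subproof n : injectiveb [ffun i : 'I_n => i].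
Proof. by apply/injectiveP => i j; rewrite !ffunE. Qed.

Definition fid n : face n n := Face [ffun=> false] (fid_subproof n).

Lemma fcomp_subproof l m n (f : face m n) (g : face l m) :
  injectiveb [ffun i => fdir f (fdir g i)].
Proof.
apply/injectiveP => i j; rewrite !ffunE => /(injectiveP _ (fdir_inj f)).
exact: (injectiveP _ (fdir_inj g)).
Qed.

Definition fcomp l m n (f : face m n) (g : face l m) : face l n :=
  Face (fvertex f (fbase g)) (fcomp_subproof f g).

Lemma vertex_face_subproof n : injectiveb [ffun i : 'I_0 => widen_ord (leq0n n) i].
Proof. by apply/injectiveP => -[]. Qed.

Definition vertex_face n (x : {ffun 'I_n -> bool}) : face 0 n :=
  Face x (vertex_face_subproof n).

Lemma edge_face_subproof n (i : 'I_n) : injectiveb [ffun _ : 'I_1 => i].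
Proof. by apply/injectiveP => a b _; rewrite (ord1 a) (ord1 b). Qed.

Definition edge_face n (x : {ffun 'I_n -> bool}) (i : 'I_n) : face 1 n :=
  Face x (edge_face_subproof i).

Definition origin n : {ffun 'I_n -> bool} := [ffun=> false].
Definition axis n (i : 'I_n) : {ffun 'I_n -> bool} := [ffun j => j == i].

(* [cell X n] is the set of parametrized n-cubes of X, i.e. of characteristic
   maps [0,1]^n -> X composed with all the isometries of [0,1]^n: an n-cube of X
   in the usual sense is an orbit of the symmetry group [face n n].  [restr f c]
   is the restriction of [c] to the face [f].  In particular [X 0] is the vertex
   set and [X 1] is the set of oriented edges.  Cubes need not be embedded. *)
Record cubeset := Cubeset {
  cell :> nat -> Type;
  restr : forall m n, face m n -> cell n -> cell m;
  restr_id : forall n (c : cell n), restr (fid n) c = c;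
  restr_comp : forall l m n (f : face m n) (g : face l m) (c : cell n),
    restr (fcomp f g) c = restr g (restr f c) }.

(* The gluing folds no cube onto itself: [0,1]^n has 2^n n! distinct
   parametrizations in X, so that its interior embeds in the realization. *)
Definition cube_complex (X : cubeset) : Prop :=
  forall n (s : face n n) (c : X n), restr s c = c -> s = fid n.

Section Combinatorics.
Variable X : cubeset.

Definition corner n (c : X n) (x : {ffun 'I_n -> bool}) : X 0 :=
  restr (vertex_face x) c.

Definition side n (c : X n) (x : {ffun 'I_n -> bool}) (i : 'I_n) : X 1 :=
  restr (edge_face x i) c.

Definition src (e : X 1) : X 0 := corner e (origin 1).
Definition tgt (e : X 1) : X 0 := corner e (axis ord0).
Definition rev_edge (e : X 1) : X 1 := side e (axis ord0) ord0.

Definition square_corner (e1 e2 : X 1) : Prop :=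
  exists c : X 2, side c (origin 2) ord0 = e1 /\ side c (origin 2) ord_max = e2.

(* A simplex of the link of a vertex v is an n-cube with a corner at v; its
   vertices are the oriented edges issuing from v along the axes of the cube. *)
Record npc : Prop := Npc {
  npc_cube_complex : cube_complex X;
  npc_link_nonloop : forall n (c : X n) (i j : 'I_n),
    side c (origin n) i = side c (origin n) j -> i = j;
  npc_link_simplicial : forall n (c d : X n),
    corner c (origin n) = corner d (origin n) ->
    (forall i, side c (origin n) i = side d (origin n) i) -> c = d;
  npc_link_flag : forall n (v : X 0) (e : 'I_n -> X 1),
    (forall i, src (e i) = v) ->
    (forall i j, i != j -> square_corner (e i) (e j)) ->
    exists c : X n,
      corner c (origin n) = v /\ forall i, side c (origin n) i = e i }.

(* Only one pair of opposite sides of each parametrized square is listed; the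
   other pair and the reversed orientations come from the other
   parametrizations of the same square. *)
Definition opposite_sides (e e' : X 1) : Prop :=
  exists c : X 2,
    e = side c (origin 2) ord0 /\ e' = side c (axis ord_max) ord0.

Definition square_parallel : X 1 -> X 1 -> Prop :=
  clos_refl_sym_trans (X 1) opposite_sides.

(* Hyperplanes are the classes of this relation on (unoriented) edges. *)
Definition same_hyperplane (e e' : X 1) : Prop :=
  square_parallel e e' \/ square_parallel e (rev_edge e').

(* The hyperplanes dual to e1 and e2 meet inside some square, as its two
   midcubes. *)
Definition cross (e1 e2 : X 1) : Prop :=
  exists c : X 2, same_hyperplane e1 (side c (origin 2) ord0) /\
                  same_hyperplane e2 (side c (origin 2) ord_max).

Record special : Prop := Special {
  special_npc : npc;
  special_no_self_crossing : forall e, ~ cross e e;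
  special_two_sided : forall e, ~ square_parallel e (rev_edge e);
  special_no_self_osculation : forall e e',
    square_parallel e e' -> e <> e' -> src e = src e' -> square_corner e e';
  special_no_inter_osculation : forall e1 e2,
    ~ same_hyperplane e1 e2 -> cross e1 e2 ->
    forall e1' e2', same_hyperplane e1 e1' -> same_hyperplane e2 e2' ->
      src e1' = src e2' -> square_corner e1' e2' }.

Fixpoint edge_path (v : X 0) (p : seq (X 1)) (w : X 0) : Prop :=
  if p is e :: q then src e = v /\ edge_path (tgt e) q w else v = w.

Definition connected : Prop :=
  (exists v : X 0, True) /\ forall v w : X 0, exists p, edge_path v p w.

Inductive elementary_homotopy : seq (X 1) -> seq (X 1) -> Prop :=
| Backtrack (p q : seq (X 1)) (e : X 1) :
    elementary_homotopy (p ++ [:: e; rev_edge e] ++ q) (p ++ q)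
| AcrossSquare (p q : seq (X 1)) (c : X 2) :
    elementary_homotopy
      (p ++ [:: side c (origin 2) ord0; side c (axis ord0) ord_max] ++ q)
      (p ++ [:: side c (origin 2) ord_max; side c (axis ord_max) ord0] ++ q).

(* Homotopy rel endpoints; all the intermediate paths run from v to w. *)
Definition homotopic (v w : X 0) : seq (X 1) -> seq (X 1) -> Prop :=
  clos_refl_sym_trans (seq (X 1))
    (fun p q => [/\ edge_path v p w, edge_path v q w & elementary_homotopy p q]).

Definition simply_connected : Prop :=
  connected /\
  forall (v : X 0) (p : seq (X 1)), edge_path v p v -> homotopic v v p [::].

(* By Gromov's link condition, this is CAT(0) for the piecewise Euclidean
   length metric. *)
Definition cat0 : Prop := npc /\ simply_connected.

Definition compact_complex : Prop := finite_set [set: {n : nat & X n}].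

Definition locally_finite : Prop := forall v : X 0,
  finite_set [set c : {n : nat & X n} | exists x, corner (projT2 c) x = v].

(* The vertices of the component, on the side of the target of e, of the
   complement of the hyperplane dual to e. *)
Definition halfspace (e : X 1) : set (X 0) :=
  [set u | exists p, edge_path (tgt e) p u /\
                     List.Forall (fun e' => ~ same_hyperplane e e') p].

Definition parallel (e e' : X 1) : Prop := halfspace e = halfspace e'.

Definition span_square (e1 e2 : X 1) : Prop :=
  ~ same_hyperplane e1 e2 /\ cross e1 e2.

Record admissible (Sigma0 : finType) (inv : Sigma0 -> Sigma0)
    (l : X 1 -> Sigma0) : Prop := Admissible {
  label_involutive : involutive inv;
  label_fixpoint_free : forall s, inv s <> s;
  label_parallel : forall e e', parallel e e' -> l e = l e';
  label_rev : forall e, l (rev_edge e) = inv (l e);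
  label_inj : forall e e', src e = src e' -> l e = l e' -> e = e';
  label_square : forall e1 e2 e1' e2',
    src e1 = src e2 -> src e1' = src e2' -> l e1 = l e1' -> l e2 = l e2' ->
    (span_square e1 e2 <-> span_square e1' e2') }.

End Combinatorics.

Record hom (X Y : cubeset) := Hom {
  hmap :> forall n, X n -> Y n;
  hom_restr : forall m n (f : face m n) (c : X n),
    hmap (restr f c) = restr f (hmap c) }.

Definition hom_id (X : cubeset) : hom X X :=
  @Hom X X (fun n c => c) (fun m n f c => erefl).

Lemma hom_comp_subproof (X Y Z : cubeset) (g : hom Y Z) (h : hom X Y) m n
    (f : face m n) (c : X n) :
  g m (h m (restr f c)) = restr f (g n (h n c)).
Proof. by rewrite !hom_restr. Qed.

Definition hom_comp (X Y Z : cubeset) (g : hom Y Z) (h : hom X Y) : hom X Z :=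
  Hom (@hom_comp_subproof X Y Z g h).

Definition inverse_of (X : cubeset) (g h : hom X X) : Prop :=
  forall n (c : X n), h n (g n c) = c /\ g n (h n c) = c.

Definition automorphism (X : cubeset) (g : hom X X) : Prop :=
  exists h : hom X X, inverse_of g h.

Record subgroup_of_Aut (X : cubeset) (Gamma : set (hom X X)) : Prop :=
  SubgroupOfAut {
  Gamma_id : Gamma (hom_id X);
  Gamma_comp : forall g h, Gamma g -> Gamma h -> Gamma (hom_comp g h);
  Gamma_inv : forall g, Gamma g -> exists2 h, Gamma h & inverse_of g h }.

Definition has_invariant_admissible_labeling (X : cubeset)
    (Gamma : set (hom X X)) : Prop :=
  exists (Sigma0 : finType) (inv : Sigma0 -> Sigma0) (l : X 1 -> Sigma0),
    admissible inv l /\ forall g, Gamma g -> forall e, l (g 1 e) = l e.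

Definition cocompact (X : cubeset) (Gamma : set (hom X X)) : Prop :=
  exists2 K : set {n : nat & X n}, finite_set K &
    forall n (c : X n), exists g d, [/\ Gamma g, K (existT _ n d) & g n d = c].

(* A point of the realization fixed by g lies in the interior of a cube that g
   maps to itself; conversely g then fixes the centre of that cube. *)
Definition acts_freely (X : cubeset) (Gamma : set (hom X X)) : Prop :=
  forall g, Gamma g ->
    (exists n (c : X n) (s : face n n), g n c = restr s c) ->
    forall m (d : X m), g m d = d.

(* Onto, and bijective from the star of each vertex to the star of its image. *)
Definition covering (X Y : cubeset) (p : hom X Y) : Prop :=
  (forall y : Y 0, exists x : X 0, p 0 x = y) /\
  forall (x : X 0) n (d : Y n), corner d (origin n) = p 0 x ->
    exists! c : X n, corner c (origin n) = x /\ p n c = d.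

Definition universal_covering (X Y : cubeset) (p : hom X Y) : Prop :=
  covering p /\ simply_connected X.

(* For a universal covering p of Y, this group is the image of the fundamental
   group of Y in Aut(X). *)
Definition deck_group (X Y : cubeset) (p : hom X Y) : set (hom X X) :=
  [set g | automorphism g /\ forall n (c : X n), p n (g n c) = p n c].

Section Quotient.
Variables (X : cubeset) (Gamma : set (hom X X)).

Definition orbit n (c : X n) : set (X n) := [set g n c | g in Gamma].

Definition quotient_cell (n : nat) : Type :=
  {A : set (X n) | exists c, A = orbit c}.

Lemma restr_orbit m n (f : face m n) (c : X n) :
  restr f @` orbit c = orbit (restr f c).
Proof.
rewrite /orbit image_comp; congr (_ @` Gamma).
by apply/funext => g /=; rewrite hom_restr.
Qed.

Lemma quotient_restr_subproof m n (f : face m n) (A : quotient_cell n) :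
  exists c, restr f @` sval A = orbit c.
Proof. by case: A => A /= [c ->]; exists (restr f c); rewrite restr_orbit. Qed.

Definition quotient_restr m n (f : face m n) (A : quotient_cell n) :
    quotient_cell m :=
  exist _ (restr f @` sval A) (quotient_restr_subproof f A).

Lemma quotient_restr_id n (A : quotient_cell n) : quotient_restr (fid n) A = A.
Proof.
case: A => A HA; apply: eq_exist => /=.
rewrite -[RHS]image_id; congr (_ @` A).
by apply/funext => c; rewrite restr_id.
Qed.

Lemma quotient_restr_comp l m n (f : face m n) (g : face l m)
    (A : quotient_cell n) :
  quotient_restr (fcomp f g) A = quotient_restr g (quotient_restr f A).
Proof.
apply: eq_exist => /=; rewrite image_comp; congr (_ @` _).
by apply/funext => c; rewrite restr_comp.
Qed.

Definition quotient : cubeset := Cubeset quotient_restr_id quotient_restr_comp.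

Definition quotient_map_cell n (c : X n) : quotient n :=
  exist _ (orbit c) (ex_intro _ c erefl).

Lemma quotient_map_subproof m n (f : face m n) (c : X n) :
  quotient_map_cell (restr f c) = restr f (quotient_map_cell c).
Proof. by apply: eq_exist; rewrite /= restr_orbit. Qed.

Definition quotient_map : hom X quotient := Hom quotient_map_subproof.

End Quotient.

(* Main.v *)
(* CAT(0) geometry is obtained from normal forms of edge paths, without disc
   diagrams. Call two paths equivalent if they differ by moves across squares. The
   cube (flag) condition on links implies that equivalent paths with different last
   edges end in the two sides of a square; consequently, appending an edge to a
   reduced path and cancelling a backtrack if one appears is compatible with
   elementary homotopies, and in a simply connected complex the reduced path
   between two vertices is unique up to equivalence. The vertices u whose reduced
   paths to the source of e can be made to end with the reverse of e form a
   halfspace depending only on the parallelism class of e. Hence no hyperplane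
   crosses itself; and if hyperplanes dual to two edges e, f at a vertex cross, some
   u lies in both halfspaces, so that reduced paths from u end with the reverse of e
   and with the reverse of f, and e, f span a square.

   For (a), an edge of X is labelled by the parallelism class of its image in S.
   For (b), labels of two sides of a square at a corner are neither equal nor
   inverse to each other, which makes the action free and lets the label descend
   to the quotient, where it separates whatever has to be separated. *)

Require Import Defs.
From Stdlib Require List.
From Stdlib Require Import Relation_Operators.
From mathcomp Require Import all_boot.
From mathcomp Require Import boolp classical_sets cardinality.

Set Implicit Arguments.
Unset Strict Implicit.
Unset Printing Implicit Defensive.

(** * Words in oriented edges modulo square moves *)

(* [sq a b c d] stands for a square with sides a, b, c, d such that the paths ab
   and cd run from the same corner of the square to the opposite one. *)
Record square_axioms (E : Type) (rev : E -> E) (sq : E -> E -> E -> E -> Prop) :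
    Prop := SquareAxioms {
  sq_revK : involutive rev;
  sq_sym : forall a b c d, sq a b c d -> sq c d a b;
  sq_rot : forall a b c d, sq a b c d -> sq (rev c) a d (rev b);
  sq_uniq : forall a b b' c d d', sq a b c d -> sq a b' c d' -> b = b' /\ d = d';
  sq_neq : forall a b c d, sq a b c d -> a <> c;
  sq_cube : forall a a' b b' c d e e' f,
    sq c a d b -> sq a f a' e -> sq b f b' e' ->
    exists g c' d', [/\ sq d b' g d', sq c a' g c' & sq d' e' c' e] }.

Section Words.
Variables (E : Type) (rev : E -> E) (sq : E -> E -> E -> E -> Prop).
Hypothesis ax : square_axioms rev sq.

Let revK := sq_revK ax.
Let sqC := sq_sym ax.
Let sqR := sq_rot ax.

Lemma sq_rot' a b c d : sq a b c d -> sq (rev a) c b (rev d).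
Proof. by move/sqC/sqR. Qed.

Lemma sq_rev a b c d : sq a b c d -> sq (rev b) (rev a) (rev d) (rev c).
Proof. by move/sqR/sqR/sqC. Qed.

Lemma sq_neq_end a b c d : sq a b c d -> b <> d.
Proof. by move/sq_rev/(sq_neq ax) => + bd; rewrite bd. Qed.

Lemma sq_neq_rev a b c d : sq a b c d -> b <> rev a.
Proof. by move/sq_rot'/(sq_neq ax) => + ba; rewrite ba. Qed.

Lemma sq_uniq_path a b c c' d d' :
  sq a b c d -> sq a b c' d' -> c = c' /\ d = d'.
Proof.
move=> /sq_rot' s1 /sq_rot' s2; have [-> dd] := sq_uniq ax s1 s2.
by split=> //; rewrite -[d]revK dd revK.
Qed.

(* Words are read backwards: the head of the list is the last edge of the path.
   The clause [sweq_sq] builds in the property of square moves that two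
   equivalent words with distinct last letters end in the two sides of a
   square; the equivalence is then shown to be transitive. *)
Inductive sweq : seq E -> seq E -> Prop :=
| sweq_nil : sweq [::] [::]
| sweq_cons e r s : sweq r s -> sweq (e :: r) (e :: s)
| sweq_sq a b c d r s t :
    sq a b c d -> sweq r (a :: t) -> sweq s (c :: t) -> sweq (b :: r) (d :: s).

Lemma sweq_refl r : sweq r r.
Proof. by elim: r => [|e r IH]; constructor. Qed.

Lemma sweq_sym r s : sweq r s -> sweq s r.
Proof.
elim=> [|e {}r {}s _ IH|a b c d {}r {}s t abcd rt _ st _].
- exact: sweq_nil.
- exact: sweq_cons.
- exact: sweq_sq (sqC abcd) st rt.
Qed.

Lemma sweq_size r s : sweq r s -> size r = size s.
Proof. by elim=> //= [e {}r {}s _ ->|a b c d {}r {}s t _ _ -> _ ->]. Qed.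

Lemma sweq_inv e r f s : sweq (e :: r) (f :: s) ->
  (e = f /\ sweq r s) \/
  exists a c t, [/\ sq a e c f, sweq r (a :: t) & sweq s (c :: t)].
Proof.
move=> H; inversion H as [|e0 r0 s0 rs|a b c d r0 s0 t abcd rt st]; subst.
  by left.
by right; exists a, c, t.
Qed.

(** Induction on the length of the middle word. If both equivalences end in squares, these share the
    side [f]. The sides [b] and [a'] preceding [f] either agree, and then the squares coincide, or
    lie in a third square, and [sq_cube] gives a cube whose remaining faces provide the
    equivalence. *)
Lemma sweq_trans r s t : sweq r s -> sweq s t -> sweq r t.
Proof.
have [n] := ubnP (size s); elim: n r s t => // n IH r s t.
case: s => [|f s] /=; first by move=> _ H1; inversion H1.
rewrite ltnS => sn H1 H2.
case: r t H1 H2 => [|e r] [|h t] H1 H2;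
  try by [have := sweq_size H1|have := sweq_size H2].
have sz w : sweq s w -> size w < n by move/sweq_size => <-.
case/sweq_inv: H1 => [[-> rs]|[a [b [u [sq1 ru su]]]]];
case/sweq_inv: H2 => [[fh st]|[a' [b' [u' [sq2 su' tu']]]]].
- by rewrite fh; apply: sweq_cons; apply: IH rs st.
- by apply: sweq_sq sq2 _ tu'; apply: IH rs su'.
- by rewrite -fh; apply: sweq_sq sq1 ru _; apply: IH (sweq_sym st) su.
have uu' : sweq (b :: u) (a' :: u') by apply: IH (sweq_sym su) su'.
have szu : (size (b :: u) < n) by apply: sz.
have szu' : (size (a' :: u') < n) by apply: sz.
case/sweq_inv: (uu') => [[ba uv]|[x [y [v [sq3 uv uv']]]]].
  rewrite ba in sq1; have [ab eh] := sq_uniq_path (sqC sq1) sq2; subst b' h.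
  apply: sweq_cons; apply: (IH r (a :: u) t szu ru).
  exact: (IH _ (a :: u') t szu' (sweq_cons a uv) (sweq_sym tu')).
have [g [c' [d' [s1 s2 s3]]]] := sq_cube ax sq3 (sqC sq1) sq2.
have szv : size (a :: x :: v) < n by rewrite /= -[(size v).+1](sweq_size uv).
have szv' : size (b' :: y :: v) < n by rewrite /= -[(size v).+1](sweq_size uv').
apply: (sweq_sq (t := g :: v) (sqC s3)).
  apply: (IH _ (a :: u) _ szu ru).
  apply: (IH _ (a :: x :: v) _ szv (sweq_cons a uv)).
  exact: sweq_sq s2 (sweq_refl _) (sweq_refl _).
apply: (IH _ (b' :: u') _ szu' tu').
apply: (IH _ (b' :: y :: v) _ szv' (sweq_cons b' uv')).
exact: sweq_sq s1 (sweq_refl _) (sweq_refl _).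
Qed.

Lemma sweq_cancel e r s : sweq (e :: r) (e :: s) -> sweq r s.
Proof.
case/sweq_inv => [[_ //]|[a [c [t [abcd _ _]]]]].
by case: (sq_neq_end abcd).
Qed.

Lemma sweq_swap a b c d t : sq a b c d -> sweq (b :: a :: t) (d :: c :: t).
Proof. by move=> s; apply: sweq_sq s (sweq_refl _) (sweq_refl _). Qed.

(** * Reduced words and normal forms of paths *)

Definition ends (r : seq E) (e : E) : Prop := exists t, sweq r (e :: t).

Lemma ends_sweq r s e : sweq r s -> ends r e -> ends s e.
Proof. by move=> rs [t rt]; exists t; apply: sweq_trans (sweq_sym rs) rt. Qed.

Fixpoint reduced (r : seq E) : Prop :=
  if r is e :: s then reduced s /\ ~ ends s (rev e) else True.

(** A backtrack at the end of [c :: t] or of [f :: s], moved across the square, would give one in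
    [e :: r] or in [a :: t]. *)
Lemma reduced_sweq r s : sweq r s -> reduced r -> reduced s.
Proof.
have [n] := ubnP (size r); elim: n r s => // n IH [|e r] [|f s] //= rn rs;
  try by have := sweq_size rs.
move=> [redr nr].
case/sweq_inv: rs => [[<- rs]|[a [c [t [sqr rt st]]]]].
  split; first exact: IH rs redr.
  by move=> /(ends_sweq (sweq_sym rs)).
have /= [redt nt] := IH _ _ rn rt redr.
have redct : reduced (c :: t).
  split=> // -[u tu]; apply: nr; exists (f :: u).
  apply: (sweq_trans rt); apply: (sweq_trans (sweq_cons a tu)).
  exact: sweq_swap (sq_rot' (sqC sqr)).
split.
  apply: (IH (c :: t)) (sweq_sym st) redct.
  by rewrite -(sweq_size st); case: (sweq_size (sweq_sq sqr rt st)) => <-.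
move=> /(ends_sweq st) [u] /sweq_inv [[cf _]|[x [y [v [sq2 tv _]]]]].
  by case: (sq_neq_rev (sqC sqr)); rewrite cf revK.
apply: nt; exists v.
have := sq_rev sq2; rewrite revK => sq3.
have [xa _] := sq_uniq ax sq3 (sq_rot' (sqC sqr)).
by rewrite -xa revK.
Qed.

(** The shortened word is a choice, determined only up to [sweq]. *)
Definition step (r : seq E) (e : E) : seq E :=
  if pselect (ends r (rev e)) is left h then sval (cid h) else e :: r.

Lemma stepP r e :
  sweq r (rev e :: step r e) \/ (~ ends r (rev e) /\ step r e = e :: r).
Proof.
by rewrite /step; case: pselect => [h|nh]; [left; apply: svalP (cid h)|right].
Qed.

Lemma step_ends r e t : sweq r (rev e :: t) -> sweq (step r e) t.
Proof.
move=> rt; case: (stepP r e) => [h|[]]; last by case; exists t.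
exact: sweq_cancel (sweq_trans (sweq_sym h) rt).
Qed.

Lemma step_nends r e : ~ ends r (rev e) -> step r e = e :: r.
Proof. by move=> nr; case: (stepP r e) => [h|[]//]; case: nr; exists (step r e). Qed.

Lemma reduced_step r e : reduced r -> reduced (step r e).
Proof.
move=> redr; case: (stepP r e) => [h|[nr ->]//].
by have [] := reduced_sweq h redr.
Qed.

Lemma step_sweq r s e : sweq r s -> sweq (step r e) (step s e).
Proof.
move=> rs; case: (stepP s e) => [h|[ns ->]].
  by apply: step_ends; apply: sweq_trans rs h.
rewrite step_nends; first exact: sweq_cons.
by move/(ends_sweq rs).
Qed.

Lemma step_revK r e : reduced r -> sweq (step (step r e) (rev e)) r.
Proof.
move=> redr; case: (stepP r e) => [h|[nr ->]].
  have [_ nr] := reduced_sweq h redr.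
  by rewrite step_nends //; apply: sweq_sym.
by apply: step_ends; rewrite revK; apply: sweq_refl.
Qed.

Lemma ends_step_rev r e : reduced r -> ends (step r e) e <-> ~ ends r (rev e).
Proof.
move=> redr; split=> [rt|nr]; last by rewrite step_nends //; exists r; apply: sweq_refl.
case: (stepP r e) => [h|[] //].
by have [_ nr] := reduced_sweq h redr; case: nr; rewrite revK.
Qed.

(** Distinct last edges of equivalent words are sides of a square, read here from its corner at the
    end of the path, where [e] and [f] start. *)
Lemma ends_both r e f : e <> f -> ends r (rev e) -> ends r (rev f) ->
  exists e' f' t, [/\ sq e f' f e', sweq r [:: rev e, rev f' & t]
                   & sweq r [:: rev f, rev e' & t]].
Proof.
move=> ef [r1 h1] [r2 h2].
case/sweq_inv: (sweq_trans (sweq_sym h1) h2) => [[ee _]|[a [c [t [s h3 h4]]]]].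
  by case: ef; rewrite -[e]revK ee revK.
exists (rev c), (rev a), t; split.
- by have := sq_rev s; rewrite !revK.
- by apply: sweq_trans h1 _; rewrite revK; apply: sweq_cons.
- by apply: sweq_trans h2 _; rewrite revK; apply: sweq_cons.
Qed.

(** If [r] can also end with [rev c], it runs through the whole square by [ends_both], and
    cancelling [rev c] leaves [rev d] last. Otherwise [c] is appended, and [rev a] followed by [c]
    is moved across the square. *)
Lemma ends_sq_step a b c d r : sq a b c d ->
  ends r (rev a) -> ends (step r c) (rev d).
Proof.
move=> s ra; case: (stepP r c) => [h|[nr ->]].
  have rc : ends r (rev c) by exists (step r c).
  have [a' [c' [t [s' h1 h2]]]] := ends_both (sq_neq ax s) ra rc.
  have [_ dd] := sq_uniq ax s s'.
  by exists t; rewrite dd; apply: step_ends h2.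
have [t rt] := ra; exists (b :: t).
apply: (sweq_trans (sweq_cons c rt)).
exact: sweq_swap (sq_rot' s).
Qed.

Lemma ends_sq a b c d r : reduced r -> sq a b c d ->
  ends r (rev a) <-> ends (step r c) (rev d).
Proof.
move=> redr s; split; first exact: ends_sq_step s.
move/(ends_sq_step (sqC (sqR s))); apply: ends_sweq; exact: step_revK.
Qed.

(** Cases by which of [rev a], [rev c] can end [r]: with both, the two paths cancel through the
    square; with one, a cancellation and an addition are interchanged; with none, both edges are
    appended. *)
Lemma step_sq a b c d r : reduced r -> sq a b c d ->
  sweq (step (step r a) b) (step (step r c) d).
Proof.
move=> redr s.
have one a' b' c' d' : sq a' b' c' d' ->
    ends r (rev a') -> ~ ends r (rev c') ->
    sweq (step (step r a') b') (step (step r c') d').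
  move=> s' [t rt] nc; rewrite (step_nends nc).
  apply: sweq_trans (step_sweq _ (step_ends rt)) _.
  rewrite step_nends; last first.
    move=> [v tv]; apply: nc; exists (rev d' :: v).
    apply: sweq_trans rt _; apply: sweq_trans (sweq_cons _ tv) _.
    exact: sweq_swap (sq_rev s').
  apply: sweq_sym; apply: step_ends.
  apply: sweq_trans (sweq_cons _ rt) _.
  exact: sweq_swap (sq_rot' s').
have none a' b' c' d' : sq a' b' c' d' ->
    ~ ends r (rev a') -> ~ ends r (rev c') ->
    step (step r a') b' = [:: b', a' & r].
  move=> s' na nc; rewrite (step_nends na) step_nends // => rb.
  have ra : ends (a' :: r) (rev (rev a')).
    by rewrite revK; exists r; apply: sweq_refl.
  (* The square at the corner of [b'] and [rev a'] is [s'] again, so [r] would end with [rev c']. *)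
  have [e [f [t [s2 _]]]] := ends_both (sq_neq_rev s') rb ra.
  rewrite revK => /sweq_cancel h.
  have [_ ce] := sq_uniq ax (sqC (sq_rot' s')) s2.
  by apply: nc; exists t; rewrite ce.
have [ra|na] := pselect (ends r (rev a)); have [rc|nc] := pselect (ends r (rev c)).
- have [d' [b' [t [s' h1 h2]]]] := ends_both (sq_neq ax s) ra rc.
  have [bb dd] := sq_uniq ax s s'; subst b' d'.
  have st x y : sweq r [:: rev x, rev y & t] -> sweq (step (step r x) y) t.
    move=> h; apply: step_ends; exact: step_ends h.
  exact: sweq_trans (st _ _ h1) (sweq_sym (st _ _ h2)).
- exact: one.
- by apply: sweq_sym; apply: one => //; apply: sqC.
- by rewrite (none _ _ _ _ s) // (none _ _ _ _ (sqC s)) //; apply: sweq_swap.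
Qed.

Definition nf (p : seq E) : seq E := foldl step [::] p.

Lemma reduced_foldl_step r p : reduced r -> reduced (foldl step r p).
Proof. by elim: p r => //= e p IH r redr; apply/IH/reduced_step. Qed.

Lemma reduced_nf p : reduced (nf p).
Proof. exact: reduced_foldl_step. Qed.

Lemma foldl_step_sweq r s p : sweq r s -> sweq (foldl step r p) (foldl step s p).
Proof. by elim: p r s => //= e p IH r s rs; apply/IH/step_sweq. Qed.

Lemma nf_backtrack p q e : sweq (nf (p ++ [:: e; rev e] ++ q)) (nf (p ++ q)).
Proof.
rewrite /nf !foldl_cat; apply: foldl_step_sweq => /=.
exact: step_revK (reduced_nf p).
Qed.

Lemma nf_square p q a b c d : sq a b c d ->
  sweq (nf (p ++ [:: a; b] ++ q)) (nf (p ++ [:: c; d] ++ q)).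
Proof.
move=> s; rewrite /nf !foldl_cat; apply: foldl_step_sweq => /=.
exact: step_sq (reduced_nf p) s.
Qed.

End Words.

(** * Vertices, edges and squares of cubes *)

Definition flip n (x : {ffun 'I_n -> bool}) (i : 'I_n) : {ffun 'I_n -> bool} :=
  [ffun j => x j (+) (j == i)].

Lemma flipK n (x : {ffun 'I_n -> bool}) i : flip (flip x i) i = x.
Proof. by apply/ffunP => j; rewrite !ffunE -addbA addbb addbF. Qed.

Lemma flipC n (x : {ffun 'I_n -> bool}) i j : flip (flip x i) j = flip (flip x j) i.
Proof. by apply/ffunP => k; rewrite !ffunE addbAC. Qed.

Lemma axisE n (i : 'I_n) : axis i = flip (origin n) i.
Proof. by apply/ffunP => j; rewrite !ffunE. Qed.

Lemma face_eq m n (f g : face m n) : fdir f = fdir g -> fbase f = fbase g -> f = g.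
Proof.
case: f g => [d b h] [d' b' h'] /= dd bb; subst d' b'.
by rewrite (bool_irrelevance h h').
Qed.

Lemma fvertex_origin m n (f : face m n) : fvertex f (origin m) = fbase f.
Proof.
apply/ffunP => j; rewrite ffunE; case: existsP => [[i]|_]; last by rewrite addbF.
by rewrite !ffunE andbF.
Qed.

Lemma fvertex_flip m n (f : face m n) x i :
  fvertex f (flip x i) = flip (fvertex f x) (fdir f i).
Proof.
apply/ffunP => j; rewrite !ffunE -addbA; congr (_ (+) _).
have [->|ji] := eqVneq j (fdir f i).
  have E y : [exists k, (fdir f k == fdir f i) && y k] = y i.
    apply/existsP/idP => [[k]|yi]; last by exists i; rewrite eqxx.
    by case/andP=> /eqP/(injectiveP _ (fdir_inj f)) ->.
  by rewrite !E ffunE eqxx.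
rewrite addbF; apply: eq_existsb => k; rewrite ffunE.
case: (eqVneq k i) => [->|]; last by rewrite addbF.
by rewrite eq_sym (negbTE ji).
Qed.

Lemma ord2P (i : 'I_2) : i = ord0 \/ i = ord_max.
Proof. by case: i => -[|[|//]] h; [left|right]; apply: val_inj. Qed.

Definition face2_dir n (i j : 'I_n) : {ffun 'I_2 -> 'I_n} :=
  [ffun k => if k == ord0 then i else j].

Lemma face2_dir_inj n (i j : 'I_n) : i != j -> injectiveb (face2_dir i j).
Proof.
move=> ij; apply/injectiveP => -[[|[|//]] h] [[|[|//]] h'];
  rewrite !ffunE //= => e; try exact/val_inj; by rewrite e eqxx in ij.
Qed.

Definition face2 n (x : {ffun 'I_n -> bool}) (i j : 'I_n) (ij : i != j) :
  face 2 n := Face x (face2_dir_inj ij).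

Section Cubes.
Variable X : cubeset.

Lemma corner_restr m n (f : face m n) (c : X n) x :
  corner (restr f c) x = corner c (fvertex f x).
Proof.
rewrite /corner -restr_comp; congr restr; apply: face_eq => //.
by apply/ffunP => -[].
Qed.

Lemma side_restr m n (f : face m n) (c : X n) x i :
  side (restr f c) x i = side c (fvertex f x) (fdir f i).
Proof.
rewrite /side -restr_comp; congr restr; apply: face_eq => //.
by apply/ffunP => k; rewrite !ffunE.
Qed.

Lemma src_side n (c : X n) x i : src (side c x i) = corner c x.
Proof. by rewrite /src /side corner_restr fvertex_origin. Qed.

Lemma tgt_side n (c : X n) x i : tgt (side c x i) = corner c (flip x i).
Proof. by rewrite /tgt /side corner_restr axisE fvertex_flip fvertex_origin ffunE. Qed.

Lemma rev_side n (c : X n) x i : rev_edge (side c x i) = side c (flip x i) i.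
Proof.
by rewrite /rev_edge [side c x i]/side side_restr axisE fvertex_flip fvertex_origin ffunE.
Qed.

Lemma side_edge (e : X 1) : side e (origin 1) ord0 = e.
Proof.
rewrite /side (_ : edge_face _ _ = fid 1) ?restr_id //; apply: face_eq => //.
by apply/ffunP => k; rewrite !ffunE (ord1 k).
Qed.

Lemma rev_edgeK : involutive (@rev_edge X).
Proof. by move=> e; rewrite -[e in LHS]side_edge !rev_side flipK side_edge. Qed.

Lemma src_rev (e : X 1) : src (rev_edge e) = tgt e.
Proof. by rewrite -[e]side_edge rev_side src_side tgt_side. Qed.

Lemma tgt_rev (e : X 1) : tgt (rev_edge e) = src e.
Proof. by rewrite -src_rev rev_edgeK. Qed.

Definition square (a b c d : X 1) : Prop := exists Q : X 2,
  [/\ side Q (origin 2) ord0 = a, side Q (axis ord0) ord_max = b,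
      side Q (origin 2) ord_max = c & side Q (axis ord_max) ord0 = d].

Lemma square_side n (c : X n) x i j : i != j ->
  square (side c x i) (side c (flip x i) j) (side c x j) (side c (flip x j) i).
Proof.
move=> ij; exists (restr (face2 x ij) c).
by rewrite !side_restr !axisE !fvertex_flip !fvertex_origin !ffunE.
Qed.

Lemma square_sym a b c d : square a b c d -> square c d a b.
Proof.
case=> Q [<- <- <- <-]; rewrite !axisE; exact: square_side.
Qed.

Lemma square_rot a b c d : square a b c d -> square (rev_edge c) a d (rev_edge b).
Proof.
case=> Q [<- <- <- <-]; rewrite !axisE !rev_side.
rewrite -{2}[origin 2](flipK _ ord_max) [flip (flip _ ord0) _]flipC.
exact: square_side.
Qed.

Lemma src_square a b c d : square a b c d -> src a = src c.
Proof. by case=> Q [<- _ <- _]; rewrite !src_side. Qed.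

Lemma tgt_square a b c d : square a b c d ->
  [/\ tgt a = src b, tgt c = src d & tgt b = tgt d].
Proof.
by case=> Q [<- <- <- <-]; rewrite !axisE !src_side !tgt_side flipC.
Qed.

Lemma square_corner_square a b c d : square a b c d -> square_corner a c.
Proof. by case=> Q [<- _ <- _]; exists Q. Qed.

Lemma square_cornerP a c : square_corner a c -> exists b d, square a b c d.
Proof. by case=> Q [<- <-]; do 2 eexists; exists Q. Qed.

Lemma opposite_sides_square a b c d : square a b c d -> opposite_sides a d.
Proof. by case=> Q [<- _ _ <-]; exists Q. Qed.

Lemma opposite_sidesP a d : opposite_sides a d -> exists b c, square a b c d.
Proof. by case=> Q [-> ->]; do 2 eexists; exists Q. Qed.

Lemma square_uniq a b b' c d d' : npc X ->
  square a b c d -> square a b' c d' -> b = b' /\ d = d'.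
Proof.
case=> _ _ simpl _ [Q [<- <- <- <-]] [Q' [a1 <- c1 <-]].
rewrite (simpl _ Q Q') //.
  by rewrite -(src_side Q _ ord0) -a1 src_side.
by move=> i; case: (ord2P i) => ->.
Qed.

(** [sq_cube] is the flag condition: the reverses of [a] and [b] and the edge [f] pairwise span
    squares at the source of [f], hence span a 3-cube, whose faces at that vertex are the given
    squares by [square_uniq]. *)
Lemma square_axioms_npc : npc X -> square_axioms (@rev_edge X) square.
Proof.
move=> npcX; have [_ nonloop _ flag] := npcX; split.
- exact: rev_edgeK.
- exact: square_sym.
- exact: square_rot.
- by move=> a b b' c d d'; exact: square_uniq.
- by move=> a b c d [Q [<- _ <- _]] /nonloop.
move=> a a' b b' c d e e' f s1 s2 s3.
pose E (i : 'I_3) := nth f [:: rev_edge a; rev_edge b; f] i.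
have t1 := square_sym (square_rot (square_rot s1)).
have t2 := square_rot (square_sym s2).
have t3 := square_rot (square_sym s3).
pose i0 : 'I_3 := ord0. pose i1 : 'I_3 := inord 1. pose i2 : 'I_3 := ord_max.
have i3P (i : 'I_3) : [\/ i = i0, i = i1 | i = i2].
  by case: i => -[|[|[|//]]] h; [constructor 1|constructor 2|constructor 3];
    apply: val_inj; rewrite /= ?inordK.
have [E0 E1 E2] : [/\ E i0 = rev_edge a, E i1 = rev_edge b & E i2 = f].
  by rewrite /E /= inordK.
have cornerC (x y : X 1) : square_corner x y -> square_corner y x.
  by move/square_cornerP => [b1 [d1 /square_sym/square_corner_square]].
have c01 : square_corner (E i0) (E i1).
  by rewrite E0 E1; apply: square_corner_square t1.
have c02 : square_corner (E i0) (E i2).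
  by rewrite E0 E2; apply: square_corner_square t2.
have c12 : square_corner (E i1) (E i2).
  by rewrite E1 E2; apply: square_corner_square t3.
have [||C [_ CE]] := flag 3 (src f) E.
- move=> i; case: (i3P i) => ->; rewrite ?E0 ?E1 ?E2 // src_rev.
    by have [] := tgt_square s2.
  by have [] := tgt_square s3.
- by move=> i j; case: (i3P i) => ->; case: (i3P j) => -> //;
     rewrite ?eqxx // => _; auto.
have [n01 n02 n12] : [/\ i0 != i1, i0 != i2 & i1 != i2].
  by rewrite -!val_eqE /= !inordK.
have q01 := square_side C (origin 3) n01; have q02 := square_side C (origin 3) n02.
have q12 := square_side C (origin 3) n12.
rewrite !CE E0 E1 E2 in q01 q02 q12.
have [rc rd] := square_uniq npcX t1 q01.
have [a'E re] := square_uniq npcX t2 q02.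
have [b'E re'] := square_uniq npcX t3 q12.
(* [x] is the common source of [c] and [d]; the new edge [g] leaves it in the direction of [f]. *)
pose x := flip (flip (origin 3) i1) i0.
have x0 : flip x i0 = flip (origin 3) i1 by rewrite flipK.
have x1 : flip x i1 = flip (origin 3) i0 by rewrite /x flipC flipK.
have z0 : flip (flip x i2) i0 = flip (flip (origin 3) i2) i1.
  by rewrite flipC x0 flipC.
have z1 : flip (flip x i2) i1 = flip (flip (origin 3) i2) i0.
  by rewrite flipC x1 flipC.
clearbody x; exists (side C x i2), (side C (flip x i2) i1), (side C (flip x i2) i0).
rewrite a'E b'E -[c]rev_edgeK -[d]rev_edgeK -[e]rev_edgeK -[e']rev_edgeK.
rewrite rc rd re re' !rev_side -z0 -z1 -x0 -x1 !flipK; split; exact: square_side.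
Qed.

Lemma square_neq_rev a b c d : square a b c d -> npc X -> b <> rev_edge a.
Proof. by move=> s npcX; apply: sq_neq_rev s; apply: square_axioms_npc. Qed.

(** * Parallelism, hyperplanes and crossing *)

Lemma square_parallel_rev (e f : X 1) :
  square_parallel e f -> square_parallel (rev_edge e) (rev_edge f).
Proof.
elim=> [{}e {}f /opposite_sidesP [b [c s]]|{}e|{}e {}f _|{}e {}f g _ ef _ fg].
- apply: rst_step; apply: opposite_sides_square.
  exact: square_sym (square_rot (square_rot (square_rot s))).
- exact: rst_refl.
- exact: rst_sym.
- exact: rst_trans ef fg.
Qed.

Lemma square_parallel_sq a b c d : square a b c d -> square_parallel a d.
Proof. by move=> s; apply: rst_step; apply: opposite_sides_square s. Qed.

Lemma same_hyperplane_refl (e : X 1) : same_hyperplane e e.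
Proof. by left; apply: rst_refl. Qed.

Lemma same_hyperplane_rev (e : X 1) : same_hyperplane e (rev_edge e).
Proof. by right; rewrite rev_edgeK; apply: rst_refl. Qed.

Lemma same_hyperplane_sym (e f : X 1) : same_hyperplane e f -> same_hyperplane f e.
Proof.
case=> [ef|/square_parallel_rev ef]; [left|right]; apply: rst_sym => //.
by rewrite rev_edgeK in ef.
Qed.

Lemma same_hyperplane_trans (e f g : X 1) :
  same_hyperplane e f -> same_hyperplane f g -> same_hyperplane e g.
Proof.
case=> ef [fg|fg].
- by left; apply: rst_trans ef fg.
- by right; apply: rst_trans ef fg.
- by right; apply: rst_trans ef _; apply: square_parallel_rev.
- left; apply: rst_trans ef _.
  by have := square_parallel_rev fg; rewrite rev_edgeK.
Qed.

Lemma same_hyperplane_sq a b c d : square a b c d -> same_hyperplane a d.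
Proof. by left; apply: square_parallel_sq H. Qed.

Lemma crossP (e f : X 1) : cross e f <->
  exists a b c d, [/\ square a b c d, same_hyperplane e a & same_hyperplane f c].
Proof.
split=> [[Q [ea fc]]|[a [b [c [d [[Q [<- _ <- _]] ea fc]]]]]]; last by exists Q.
by do 4 eexists; split; [exists Q|exact: ea|exact: fc].
Qed.

(** Reflecting the square in one coordinate reverses one pair of opposite sides and keeps the other,
    so both orientations can be adjusted independently. *)
Lemma cross_square (e f : X 1) : cross e f ->
  exists a b c d, [/\ square a b c d, square_parallel e a & square_parallel f c].
Proof.
case/crossP => [a [b [c [d [s ea fc]]]]].
have {a b c d s ea fc} [a [b [c [d [s ea fc]]]]] : exists a b c d,
    [/\ square a b c d, square_parallel e a & same_hyperplane f c].
  case: ea => ea; first by exists a, b, c, d.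
  exists (rev_edge a), c, b, (rev_edge d); split=> //.
    exact: square_rot (square_sym s).
  exact: same_hyperplane_trans fc (same_hyperplane_sq (square_sym s)).
case: fc => fc; first by exists a, b, c, d.
exists d, (rev_edge b), (rev_edge c), a; split=> //.
  exact: square_sym (square_rot s).
exact: rst_trans ea (square_parallel_sq s).
Qed.

Lemma edge_path_cat (u v w : X 0) p q :
  edge_path u p v -> edge_path v q w -> edge_path u (p ++ q) w.
Proof. by elim: p u => [|e p IH] u /= => [->|[-> pv] qw] //; split=> //; apply: IH. Qed.

Definition inverse_path (p : seq (X 1)) := rev (map (@rev_edge X) p).

Lemma edge_path_inverse (u v : X 0) p : edge_path u p v -> edge_path v (inverse_path p) u.
Proof.
elim: p u => [|e p IH] u /= => [->|[eu pv]] //.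
rewrite /inverse_path /= rev_cons -cats1; apply: edge_path_cat (IH _ pv) _.
by rewrite /= src_rev tgt_rev.
Qed.
End Cubes.

(** * Hyperplanes and halfspaces *)

Section Separation.
Variable X : cubeset.

Definition crossing_parity (e : X 1) (p : seq (X 1)) : bool :=
  odd (count (fun f => `[< same_hyperplane e f >]) p).

(** A backtrack crosses one hyperplane twice, and a square move only permutes the hyperplanes
    crossed. *)
Lemma crossing_parity_homotopic (e : X 1) u v p q :
  homotopic u v p q -> crossing_parity e p = crossing_parity e q.
Proof.
elim=> [{}p {}q [_ _ h]|//|{}p {}q _ -> //|{}p {}q r _ -> _ -> //].
have hp f g : same_hyperplane f g ->
    `[< same_hyperplane e f >] = `[< same_hyperplane e g >].
  move=> fg; apply: asbool_equiv_eq; split=> eh.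
    exact: same_hyperplane_trans eh fg.
  exact: same_hyperplane_trans eh (same_hyperplane_sym fg).
case: h => {}p {}q => [f|Q]; rewrite /crossing_parity !count_cat !oddD /=.
  by rewrite -(hp _ _ (same_hyperplane_rev f)) addbF addbb.
have s : square (side Q (origin 2) ord0) (side Q (axis ord0) ord_max)
  (side Q (origin 2) ord_max) (side Q (axis ord_max) ord0) by exists Q.
rewrite (hp _ _ (same_hyperplane_sq s)).
by rewrite (hp _ _ (same_hyperplane_sq (square_sym s))) !addbF [odd _ (+) odd _]addbC.
Qed.

(* A path from [tgt e] to [src e] avoiding the hyperplane of [e], followed by
   [e], would be a loop crossing that hyperplane once. *)
Lemma src_notin_halfspace (e : X 1) : simply_connected X -> ~ halfspace e (src e).
Proof.
move=> [_ scX] [p [pe avoid]].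
have /(crossing_parity_homotopic e) : homotopic (src e) (src e) (e :: p) [::].
  by apply: scX.
rewrite /crossing_parity /= asboolT; last exact: same_hyperplane_refl.
elim: p avoid {pe} => //= f p IH avoid; inversion avoid; subst.
by rewrite asboolF // add0n; apply: IH.
Qed.

Hypothesis no_self_crossing : forall e : X 1, ~ cross e e.

(** The path is preceded by [b], which is dual to the hyperplane of [c]; this is not the hyperplane
    of [a], as [a] would cross itself. *)
Lemma square_halfspace (a b c d : X 1) : square a b c d ->
  forall u, halfspace d u -> halfspace a u.
Proof.
move=> s u [p [dp avoid]]; have [ab _ bd] := tgt_square s.
exists (b :: p); split; first by rewrite /= ab bd.
have ad := same_hyperplane_sq s; constructor.
  move=> hb; case: (@no_self_crossing a); apply/crossP.
  exists a, b, c, d; split=> //; first exact: same_hyperplane_refl.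
  have bc := same_hyperplane_sym (same_hyperplane_sq (square_sym s)).
  exact: same_hyperplane_trans hb bc.
apply: List.Forall_impl avoid => f df af; apply: df.
exact: same_hyperplane_trans (same_hyperplane_sym ad) af.
Qed.

Lemma square_parallel_parallel (e f : X 1) : square_parallel e f -> parallel e f.
Proof.
rewrite /parallel; elim=> [{}e {}f /opposite_sidesP [b [c s]]|//||]; last 2 first.
- by move=> {}e {}f _ ->.
- by move=> {}e {}f g _ -> _ ->.
apply/seteqP; split=> u; last exact: square_halfspace s u.
exact: (square_halfspace (square_sym (square_rot s))).
Qed.

(** If the hyperplanes differed, a path from [tgt f] to [tgt e] inside the common halfspace,
    followed by [rev_edge e], would put [src e] there. If [e] were parallel to [rev_edge f], that
    halfspace would contain [src f]. *)
Lemma parallel_square_parallel (e f : X 1) : simply_connected X ->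
  parallel e f -> square_parallel e f.
Proof.
move=> scX ef.
have e0 := @src_notin_halfspace e scX; have f0 := @src_notin_halfspace f scX.
have : same_hyperplane e f.
  apply: contrapT => nef; apply: e0; rewrite ef.
  have : halfspace e (tgt e) by exists [::]; split=> //; constructor.
  rewrite ef => -[p [pe avoid]]; exists (p ++ [:: rev_edge e]); split.
    by apply: edge_path_cat pe _; rewrite /= src_rev tgt_rev.
  apply/List.Forall_app; split=> //; constructor=> // fe; apply: nef.
  apply: same_hyperplane_sym; apply: same_hyperplane_trans fe _.
  exact: same_hyperplane_sym (same_hyperplane_rev e).
case=> // /square_parallel_parallel efr; case: f0.
rewrite -ef efr; exists [::]; rewrite /= tgt_rev; split=> //; constructor.
Qed.
End Separation.

(** * Normal forms and halfspaces in a CAT(0) cube complex *)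

Section CAT0.
Variable X : cubeset.
Hypothesis cat0X : cat0 X.

Let ax := square_axioms_npc (proj1 cat0X).
Local Notation rv := (@rev_edge X).
Local Notation sq := (@square X).
Local Notation normal := (nf rv sq).

Lemma nf_inverse_path (p q : seq (X 1)) :
  sweq sq (normal (p ++ inverse_path q ++ q)) (normal p).
Proof.
elim: q p => [|e q IH] p; first by rewrite /= cats0; apply: sweq_refl.
have -> : inverse_path (e :: q) = inverse_path q ++ [:: rv e].
  by rewrite /inverse_path /= rev_cons -cats1.
rewrite -catA -[e :: q]/([:: e] ++ q) [[:: rv e] ++ _]catA /=.
have := nf_backtrack ax (p ++ inverse_path q) q (rv e).
rewrite rev_edgeK -!catA => h; apply: (sweq_trans ax h); exact: IH.
Qed.

Lemma nf_homotopic u v (p q : seq (X 1)) :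
  homotopic u v p q -> sweq sq (normal p) (normal q).
Proof.
elim=> [{}p {}q [_ _ h]|{}p|{}p {}q _ /(sweq_sym ax)|{}p {}q r _ pq _]; last first.
- exact: (sweq_trans ax).
- by apply.
- exact: sweq_refl.
case: h => {}p {}q => [e|Q]; first exact: nf_backtrack.
by apply: nf_square => //; exists Q.
Qed.

(** Inserting the inverse of [q] and [q] after [p] keeps the normal form, and the loop made of [p]
    and the inverse of [q] contracts. *)
Lemma nf_unique u v (p q : seq (X 1)) :
  edge_path u p v -> edge_path u q v -> sweq sq (normal p) (normal q).
Proof.
move=> pv qv; have [_ [_ scX]] := cat0X.
apply: (sweq_trans ax (sweq_sym ax (nf_inverse_path p q))).
rewrite catA {1}/nf foldl_cat; apply: (foldl_step_sweq ax).
apply: nf_homotopic (scX u _ _).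
exact: edge_path_cat pv (edge_path_inverse qv).
Qed.

(* [ahead u e]: some geodesic from u to the source of e ends with the edge e
   reversed; in other words, u is closer to the target of e than to its source,
   i.e. it lies in the halfspace of e. *)
Definition ahead (u : X 0) (e : X 1) : Prop :=
  exists2 p, edge_path u p (src e) & ends sq (normal p) (rv e).

Lemma aheadP u p (e : X 1) : edge_path u p (src e) ->
  ahead u e <-> ends sq (normal p) (rv e).
Proof.
move=> pe; split=> [[q qe]|]; last by exists p.
exact: (ends_sweq ax (nf_unique qe pe)).
Qed.

Lemma path_ex (u v : X 0) : exists p, edge_path u p v.
Proof. by have [_ [[_ h] _]] := cat0X; apply: h. Qed.

Lemma nf_rcons p (e : X 1) : normal (p ++ [:: e]) = step rv sq (normal p) e.
Proof. by rewrite /nf foldl_cat. Qed.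

Lemma ahead_src (e : X 1) : ~ ahead (src e) e.
Proof.
have : edge_path (src e) [::] (src e) by [].
by move/aheadP => -> [t /sweq_size].
Qed.

Lemma ahead_rev u (e : X 1) : ahead u (rv e) <-> ~ ahead u e.
Proof.
have [p pe] := path_ex u (src e).
have pe' : edge_path u (p ++ [:: e]) (src (rv e)).
  by apply: edge_path_cat pe _; rewrite /= src_rev.
rewrite (aheadP pe) (aheadP pe') nf_rcons rev_edgeK.
exact: (ends_step_rev ax e (reduced_nf ax p)).
Qed.

Lemma ahead_tgt (e : X 1) : ahead (tgt e) e.
Proof. by apply: contrapT; rewrite -ahead_rev -src_rev => /ahead_src. Qed.

Lemma ahead_parallel u (e f : X 1) : square_parallel e f -> ahead u e <-> ahead u f.
Proof.
elim=> [{}e {}f /opposite_sidesP [b [c s]]|//|{}e {}f _ -> //|{}e {}f g _ -> _ -> //].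
have [p pe] := path_ex u (src e); have [_ cf _] := tgt_square s.
have pf : edge_path u (p ++ [:: c]) (src f).
  by apply: edge_path_cat pe _; rewrite /= (src_square s) cf.
rewrite (aheadP pe) (aheadP pf) nf_rcons.
exact: (ends_sq ax (reduced_nf ax p) s).
Qed.

(** At [tgt a], [ahead] holds for [a] but not for [c], which is parallel to [b], an edge starting
    there. At [src a] it fails for both, so [a] and [rev_edge c] are not parallel either. *)
Lemma cat0_sides (a b c d : X 1) : sq a b c d -> ~ same_hyperplane a c.
Proof.
move=> s [ac|ac].
  have : ahead (tgt a) c by rewrite -(ahead_parallel _ ac); apply: ahead_tgt.
  have [-> _ _] := tgt_square s.
  by rewrite (ahead_parallel _ (square_parallel_sq (square_sym s))) => /ahead_src.
have := @ahead_src a; rewrite (ahead_parallel _ ac) ahead_rev (src_square s).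
by apply; apply: ahead_src.
Qed.

Lemma cat0_no_self_crossing (e : X 1) : ~ cross e e.
Proof.
move=> /crossP [a [b [c [d [s ea ec]]]]]; apply: cat0_sides s _.
exact: same_hyperplane_trans (same_hyperplane_sym ea) ec.
Qed.

Lemma cat0_square_corner (e f : X 1) :
  src e = src f -> span_square e f -> square_corner e f.
Proof.
move=> ef [nef /cross_square [a [b [c [d [s ea fc]]]]]].
have [_ _ bd] := tgt_square s.
(* The corner [tgt b], opposite to the source of [a], lies in both halfspaces. *)
have ue : ahead (tgt b) e.
  rewrite (ahead_parallel _ ea) (ahead_parallel _ (square_parallel_sq s)) bd.
  exact: ahead_tgt.
have uf : ahead (tgt b) f.
  rewrite (ahead_parallel _ fc).
  by rewrite (ahead_parallel _ (square_parallel_sq (square_sym s))); apply: ahead_tgt.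
have [p pe] := path_ex (tgt b) (src e).
have pf : edge_path (tgt b) p (src f) by rewrite -ef.
move: ue uf; rewrite (aheadP pe) (aheadP pf) => pe' pf'.
have [|f' [e' [t [s' _ _]]]] := ends_both ax _ pe' pf'.
  by move=> E; apply: nef; rewrite E; apply: same_hyperplane_refl.
exact: square_corner_square s'.
Qed.

End CAT0.

(** * Homomorphisms and coverings *)

Section Homs.
Variables (X Y : cubeset) (p : hom X Y).

Lemma hom_corner n (c : X n) x : p 0 (corner c x) = corner (p n c) x.
Proof. exact: hom_restr. Qed.

Lemma hom_side n (c : X n) x i : p 1 (side c x i) = side (p n c) x i.
Proof. exact: hom_restr. Qed.

Lemma hom_src (e : X 1) : p 0 (src e) = src (p 1 e).
Proof. exact: hom_corner. Qed.

Lemma hom_tgt (e : X 1) : p 0 (tgt e) = tgt (p 1 e).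
Proof. exact: hom_corner. Qed.

Lemma hom_rev_edge (e : X 1) : p 1 (rev_edge e) = rev_edge (p 1 e).
Proof. exact: hom_side. Qed.

Lemma hom_square a b c d :
  square a b c d -> square (p 1 a) (p 1 b) (p 1 c) (p 1 d).
Proof. by case=> Q [<- <- <- <-]; exists (p 2 Q); rewrite !hom_side. Qed.

Lemma hom_square_corner (e f : X 1) :
  square_corner e f -> square_corner (p 1 e) (p 1 f).
Proof. by move=> /square_cornerP [b [d /hom_square/square_corner_square]]. Qed.

Lemma hom_square_parallel (e f : X 1) :
  square_parallel e f -> square_parallel (p 1 e) (p 1 f).
Proof.
elim=> [{}e {}f /opposite_sidesP [b [c s]]|{}e|{}e {}f _|{}e {}f g _ ef _ fg].
- exact: square_parallel_sq (hom_square s).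
- exact: rst_refl.
- exact: rst_sym.
- exact: rst_trans ef fg.
Qed.

Lemma hom_same_hyperplane (e f : X 1) :
  same_hyperplane e f -> same_hyperplane (p 1 e) (p 1 f).
Proof.
by case=> /hom_square_parallel; [left|right; rewrite -hom_rev_edge].
Qed.

Lemma hom_cross (e f : X 1) : cross e f -> cross (p 1 e) (p 1 f).
Proof.
case/crossP => [a [b [c [d [s ea fc]]]]]; apply/crossP.
exists (p 1 a), (p 1 b), (p 1 c), (p 1 d).
by split; [exact: hom_square|exact: hom_same_hyperplane|exact: hom_same_hyperplane].
Qed.

Hypothesis cov : covering p.

Lemma covering_inj n (c d : X n) :
  corner c (origin n) = corner d (origin n) -> p n c = p n d -> c = d.
Proof.
move=> cd pcd; have [] := proj2 cov (corner c (origin n)) n (p n c).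
  by rewrite hom_corner.
by move=> x [_ u]; rewrite -(u c) // -(u d).
Qed.

Lemma covering_lift n (B : Y n) (v : X 0) : corner B (origin n) = p 0 v ->
  exists2 c : X n, corner c (origin n) = v & p n c = B.
Proof. by case/(proj2 cov) => c [[cv cB] _]; exists c. Qed.

(** The square is lifted at [src e]; its sides there are [e] and [f] because edges lift uniquely. *)
Lemma covering_square_corner (e f : X 1) :
  src e = src f -> square_corner (p 1 e) (p 1 f) -> square_corner e f.
Proof.
move=> ef [Q [Qe Qf]].
have [|c cv cQ] := @covering_lift _ Q (src e).
  by rewrite -(src_side Q _ ord0) Qe hom_src.
have sideE g i : src g = src e -> side Q (origin 2) i = p 1 g ->
    side c (origin 2) i = g.
  move=> ge Qg; apply: covering_inj; last by rewrite hom_side cQ.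
  by rewrite -!/(src _) src_side cv ge.
by exists c; split; apply: sideE.
Qed.

(** A covering is bijective on stars, so simpliciality and flagness of a link are checked at a
    vertex above. *)
Lemma covering_npc : npc X -> cube_complex Y ->
  (forall n (c : Y n) (i j : 'I_n),
    side c (origin n) i = side c (origin n) j -> i = j) -> npc Y.
Proof.
move=> npcX cubeY nonloopY; split=> //.
  move=> n B C BC sBC.
  have [v vB] := proj1 cov (corner B (origin n)).
  have [b bv bB] := covering_lift (esym vB).
  have [c cv cC] := covering_lift (esym (etrans vB BC)).
  rewrite -bB -cC; congr (p n _).
  apply: (npc_link_simplicial npcX); first by rewrite bv.
  move=> i; apply: covering_inj; last by rewrite !hom_side bB cC.
  by rewrite -!/(src _) !src_side bv.
move=> n v e ev eij.
have [w wv] := proj1 cov v.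
have lift i : exists f : X 1, src f = w /\ p 1 f = e i.
  have [|f fw fe] := @covering_lift _ (e i) w; first by rewrite wv -(ev i).
  by exists f.
pose f i := sval (cid (lift i)).
have fw i : src (f i) = w by case: (svalP (cid (lift i))).
have fe i : p 1 (f i) = e i by case: (svalP (cid (lift i))).
have [||c [cw cf]] := npc_link_flag npcX (e := f) (v := w) => //.
  move=> i j ij; apply: covering_square_corner; rewrite ?fw // !fe; exact: eij.
exists (p n c); rewrite -hom_corner cw; split=> // i.
by rewrite -hom_side cf.
Qed.

End Homs.

(** * Labeling the universal covering of a special cube complex *)

Lemma finite_parallelism_classes (S : cubeset) : compact_complex S ->
  exists (Sigma : finType) (q : S 1 -> Sigma), (forall s, exists e, q e = s) /\
    forall e f, q e = q f <-> square_parallel e f.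
Proof.
move=> finS.
pose cls (e : S 1) : set (S 1) := [set f | square_parallel e f]%classic.
(* [F] extends the class map to cells of every dimension, with filler value [set0] outside dimension
   1. *)
pose F (c : {n : nat & S n}) : set (S 1) :=
  let: existT n c := c in
  (if n is 1 return S n -> set (S 1) then cls else fun=> set0) c.
have [s sE] : exists s : seq (set (S 1)), range cls = [set` s]%classic.
  apply/finite_seqP; apply: sub_finite_set (finite_image F finS).
  by move=> A [e _ <-]; exists (existT _ 1 e).
have clsP e : cls e \in s.
  by have : range cls (cls e); [exists e|rewrite sE].
exists (seq_sub s), (fun e => SeqSub (clsP e)); split.
  case=> A As; have : range cls A by rewrite sE.
  by case=> e _ eA; exists e; apply: val_inj.
move=> e f; split=> [[ef]|ef].
  have : cls f f by apply: rst_refl.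
  by rewrite -ef.
apply: val_inj => /=; apply/seteqP; split=> g /=; last exact: rst_trans ef.
exact: rst_trans (rst_sym _ _ _ _ ef).
Qed.

Lemma special_labeling (S X : cubeset) (p : hom X S) :
  special S -> compact_complex S -> universal_covering p ->
  has_invariant_admissible_labeling (deck_group p).
Proof.
move=> [npcS nocross twosided noself nointer] /finite_parallelism_classes
  [Sigma [q [q_onto qP]]] [cov scX].
have nocrossX (e : X 1) : ~ cross e e by move/(hom_cross p); apply: nocross.
pose inv s := q (rev_edge (sval (cid (q_onto s)))).
have invE e : inv (q e) = q (rev_edge e).
  by apply/qP; apply: square_parallel_rev; apply/qP; apply: svalP (cid (q_onto (q e))).
pose l (e : X 1) := q (p 1 e).
have same_label_cross (e f : S 1) : square_parallel e f -> ~ cross e f.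
  move=> ef /crossP [a [b [c [d [s ea fc]]]]]; apply: (nocross e); apply/crossP.
  by exists a, b, c, d; split=> //; apply: same_hyperplane_trans fc; left.
exists Sigma, inv, l; split; last by move=> g [_ pg] e; rewrite /l pg.
split.
- move=> s; have [e <-] := q_onto s; by rewrite !invE rev_edgeK.
- by move=> s; have [e <-] := q_onto s; rewrite invE => /esym/qP/twosided.
- move=> e f /(parallel_square_parallel nocrossX scX) ef.
  by apply/qP; apply: hom_square_parallel.
- by move=> e; rewrite /l invE hom_rev_edge.
- move=> e f ef /qP pef; apply: (covering_inj cov ef).
  (* Distinct parallel images at one vertex would span a square by the absence of self-osculation,
     and their hyperplane would cross itself. *)
  apply: contrapT => npef.
  have := noself _ _ pef npef; rewrite -!hom_src ef => /(_ erefl).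
  move/square_cornerP => [b [d s]]; apply: (same_label_cross _ _ pef).
  by apply/crossP; exists (p 1 e), b, (p 1 f), d; split=> //;
     apply: same_hyperplane_refl.
(* Equal labels carry the crossing in [S] over to the second pair; the absence of inter-osculation
   turns it into a square, which lifts to [X]. *)
have half (e1 e2 e1' e2' : X 1) : src e1' = src e2' ->
    l e1 = l e1' -> l e2 = l e2' -> span_square e1 e2 -> span_square e1' e2'.
  move=> src12 /qP l1 /qP l2 [_ /(hom_cross p) cr].
  have cr' : cross (p 1 e1') (p 1 e2').
    case/crossP: cr => [a [b [c [d [s h1 h2]]]]]; apply/crossP.
    exists a, b, c, d; split=> //.
      by apply: same_hyperplane_trans h1; apply: same_hyperplane_sym; left.
    by apply: same_hyperplane_trans h2; apply: same_hyperplane_sym; left.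
  have nsame : ~ same_hyperplane (p 1 e1') (p 1 e2').
    move=> h; apply: (nocross (p 1 e1')).
    case/crossP: cr' => [a [b [c [d [s h1 h2]]]]]; apply/crossP.
    exists a, b, c, d; split=> //; exact: same_hyperplane_trans h h2.
  split; first by move/(hom_same_hyperplane p).
  have := nointer _ _ nsame cr' _ _ (same_hyperplane_refl _) (same_hyperplane_refl _).
  rewrite -!hom_src src12 => /(_ erefl) /(covering_square_corner cov src12).
  move=> /square_cornerP [b [d s]]; apply/crossP.
  by exists e1', b, e2', d; split=> //; apply: same_hyperplane_refl.
move=> e1 e2 e1' e2' s12 s12' l1 l2; split; first exact: half.
by apply: half.
Qed.

(** * Labeled CAT(0) cube complexes and their quotients *)

Lemma side_parallel (X : cubeset) n (c : X n) x (j : 'I_n) :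
  square_parallel (side c x j)
    (side c (if x j then flip (origin n) j else origin n) j).
Proof.
(* [y s] is [x] with the coordinates outside [s], except [j], reset to [false]. Each actual reset
   passes to the opposite side of a square. *)
pose y (s : seq 'I_n) : {ffun 'I_n -> bool} :=
  [ffun i => if i == j then x j else x i && (i \in s)].
have -> : (if x j then flip (origin n) j else origin n) = y [::].
  apply/ffunP => i; rewrite ffunE in_nil andbF.
  by case: (x j); rewrite !ffunE ?addFb; case: eqP.
have {1}-> : x = y (enum 'I_n).
  by apply/ffunP => i; rewrite ffunE mem_enum andbT; case: eqP => [->|].
elim: (enum _) => [|i s IH]; first exact: rst_refl.
have [E|[ij E]] : y (i :: s) = y s \/ i != j /\ y (i :: s) = flip (y s) i.
  have [ij|ij] := eqVneq i j.
    left; apply/ffunP => k; rewrite !ffunE inE.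
    by have [//|kj] := eqVneq k j; rewrite ij (negbTE kj).
  have [h|h] := boolP (x i && (i \notin s)); [right; split=> //|left].
    apply/ffunP => k; rewrite !ffunE inE; have [->|ki] := eqVneq k i.
      by rewrite (negbTE ij); case/andP: h => -> /negbTE ->.
    by rewrite addbF.
  apply/ffunP => k; rewrite !ffunE inE; case: eqP => // _.
  have [->|//] := eqVneq k i.
  by move: h; case: (x i) => //=; rewrite negbK => ->.
- by rewrite E.
- rewrite E; apply: rst_trans IH; apply: rst_sym.
  rewrite eq_sym in ij; exact: square_parallel_sq (square_side c (y s) ij).
Qed.

Section LabeledQuotient.
Variables (X : cubeset) (Gamma : set (hom X X)).
Variables (Sigma0 : finType) (inv : Sigma0 -> Sigma0) (l : X 1 -> Sigma0).
Hypothesis cat0X : cat0 X.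
Hypothesis subG : subgroup_of_Aut Gamma.
Hypothesis adm : admissible inv l.
Hypothesis invariant : forall g, Gamma g -> forall e, l (g 1 e) = l e.

Let npcX : npc X := proj1 cat0X.
Let invK : involutive inv := label_involutive adm.

Lemma label_square_parallel (e f : X 1) : square_parallel e f -> l e = l f.
Proof.
move=> ef; apply: (label_parallel adm).
by apply: square_parallel_parallel ef; apply: cat0_no_self_crossing.
Qed.

(* In the square with sides a, c at a corner, the side parallel to c issues from
   the target of a, as does the reverse of a. *)
Lemma label_square_neq a b c d :
  square a b c d -> l a <> l c /\ l a <> inv (l c).
Proof.
move=> s; split=> h.
  case: (sq_neq (square_axioms_npc npcX) s).
  by apply: (label_inj adm) h; apply: src_square s.
case: (square_neq_rev s npcX); apply: (label_inj adm).
  by rewrite src_rev; have [-> _ _] := tgt_square s.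
rewrite (label_rev adm) h invK; apply: label_square_parallel.
exact: rst_sym (square_parallel_sq (square_sym s)).
Qed.

Lemma label_side n (c : X n) x j :
  l (side c x j) = if x j then inv (l (side c (origin n) j))
                   else l (side c (origin n) j).
Proof.
rewrite (label_square_parallel (side_parallel c x j)).
by case: (x j) => //; rewrite -rev_side (label_rev adm).
Qed.

(** [g] preserves labels, and distinct directions of a cube have labels neither equal nor inverse,
    so [s] fixes every direction; it reverses none because [inv] has no fixpoint. *)
Lemma cell_stabilizer g n (c : X n) (s : face n n) :
  Gamma g -> g n c = restr s c -> s = fid n.
Proof.
move=> Gg gc.
have key i : fdir s i = i /\ fbase s i = false.
  have := invariant Gg (side c (origin n) i).
  rewrite hom_side gc side_restr fvertex_origin label_side.
  have [->|si] := eqVneq (fdir s i) i.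
    by case: (fbase s i) => // /(label_fixpoint_free adm).
  have [n1 n2] := label_square_neq (square_side c (origin n) si).
  by case: ifP => _ => // h; case: n2; rewrite -h invK.
by apply: face_eq; apply/ffunP => i; rewrite ffunE; case: (key i).
Qed.

(** Labels at a vertex are distinct, so [g] fixes the edges at a fixed vertex, hence their targets
    and, by connectedness, all vertices. A cube is determined by its edges at a corner. *)
Lemma fix_vertex g v : Gamma g -> g 0 v = v -> forall n (c : X n), g n c = c.
Proof.
move=> Gg gv.
have edge (e : X 1) : g 0 (src e) = src e -> g 1 e = e.
  by move=> ge; apply: (label_inj adm); rewrite -?hom_src // invariant.
have vertex w : g 0 w = w.
  have [p] := path_ex cat0X v w.
  elim: p v gv => [|e p IH] v' gv' /= => [<- //|[ev]].
  by apply: IH; rewrite hom_tgt edge // ev.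
move=> n c; apply: (npc_link_simplicial npcX); first by rewrite -hom_corner.
by move=> i; rewrite -hom_side edge.
Qed.

Lemma labeled_acts_freely : acts_freely Gamma.
Proof.
move=> g Gg [n [c [s gc]]]; apply: (fix_vertex (v := corner c (origin n)) Gg).
by rewrite hom_corner gc (cell_stabilizer Gg gc) restr_id.
Qed.

(** * The quotient and its induced labeling *)

Local Notation Y := (quotient Gamma).
Local Notation pi := (quotient_map Gamma).

Lemma quotient_map_onto n (B : Y n) : exists c : X n, pi n c = B.
Proof. by case: B => B [c cB]; exists c; apply: eq_exist. Qed.

Lemma quotient_mapP n (c d : X n) :
  pi n c = pi n d <-> exists2 g, Gamma g & g n c = d.
Proof.
split=> [[cd]|[g Gg gc]].
  have : Defs.orbit Gamma d d by exists (hom_id X) => //; apply: Gamma_id.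
  by rewrite -cd => -[g Gg gc]; exists g.
apply: eq_exist; apply/seteqP; split=> x [h Gh <-].
  have [g' Gg' gK] := Gamma_inv subG Gg.
  exists (hom_comp h g'); first exact: Gamma_comp.
  by rewrite /= -gc; have [-> _] := gK n c.
exists (hom_comp h g); first exact: Gamma_comp.
by rewrite /= gc.
Qed.

(** Translating a preimage gives a lift; two lifts at [x] differ by an element fixing [x], which is
    trivial by [fix_vertex]. *)
Lemma covering_quotient_map : covering pi.
Proof.
split=> [y|x n D Dx]; first exact: quotient_map_onto.
have [d dD] := quotient_map_onto D.
have [g Gg gd] : exists2 g, Gamma g & g 0 (corner d (origin n)) = x.
  by apply/quotient_mapP; rewrite hom_corner dD.
exists (g n d); split.
  by rewrite -hom_corner; split=> //; rewrite -dD; apply/esym/quotient_mapP; exists g.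
move=> c [cx cD].
have [h Gh hc] : exists2 h, Gamma h & h n (g n d) = c.
  apply/quotient_mapP; rewrite cD -dD; apply/esym/quotient_mapP; by exists g.
rewrite -hc; apply/esym; apply: (fix_vertex (v := x) Gh).
by rewrite -{1}gd -cx -hc !hom_corner.
Qed.

Definition quotient_label (e : Y 1) : Sigma0 := l (sval (cid (quotient_map_onto e))).
Local Notation lY := quotient_label.

Lemma quotient_labelE (e : X 1) : lY (pi 1 e) = l e.
Proof.
have [g Gg ge] : exists2 g, Gamma g & g 1 (sval (cid (quotient_map_onto (pi 1 e)))) = e.
  by apply/quotient_mapP; case: (cid _).
by rewrite -[in RHS]ge invariant.
Qed.

Lemma quotient_square a b c d : @square Y a b c d -> exists a' b' c' d',
  [/\ @square X a' b' c' d', pi 1 a' = a, pi 1 b' = b, pi 1 c' = c & pi 1 d' = d].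
Proof.
case=> Q [<- <- <- <-]; have [Q' <-] := quotient_map_onto Q.
exists (side Q' (origin 2) ord0), (side Q' (axis ord0) ord_max),
  (side Q' (origin 2) ord_max), (side Q' (axis ord_max) ord0).
by rewrite !hom_side; split=> //; exists Q'.
Qed.

Lemma quotient_label_inj (e f : Y 1) : src e = src f -> lY e = lY f -> e = f.
Proof.
have [e' <-] := quotient_map_onto e; rewrite -hom_src => ef.
have [f' f1 <-] := covering_lift covering_quotient_map (esym ef).
by rewrite !quotient_labelE => /(label_inj adm) ->.
Qed.

Lemma quotient_label_rev (e : Y 1) : lY (rev_edge e) = inv (lY e).
Proof.
have [e' <-] := quotient_map_onto e.
by rewrite -hom_rev_edge !quotient_labelE (label_rev adm).
Qed.

Lemma quotient_label_parallel (e f : Y 1) : square_parallel e f -> lY e = lY f.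
Proof.
elim=> [{}e {}f /opposite_sidesP [b [c]]|//|{}e {}f _ -> //|{}e {}f g _ -> _ -> //].
move=> /quotient_square [e' [b' [c' [f' [s <- _ _ <-]]]]].
rewrite !quotient_labelE; apply: label_square_parallel; exact: square_parallel_sq s.
Qed.

Lemma quotient_label_square_neq (a b c d : Y 1) :
  square a b c d -> lY a <> lY c /\ lY a <> inv (lY c).
Proof.
move=> /quotient_square [a' [b' [c' [d' [s <- _ <- _]]]]].
by rewrite !quotient_labelE; apply: label_square_neq s.
Qed.

Lemma quotient_npc : npc Y.
Proof.
apply: (covering_npc covering_quotient_map npcX).
  move=> n s C; have [c <-] := quotient_map_onto C.
  rewrite -hom_restr => /esym/quotient_mapP [g Gg]; exact: cell_stabilizer.
move=> n c i j cij; apply/eqP; apply: contraT => ij.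
by have [] := quotient_label_square_neq (square_side c (origin n) ij); rewrite cij.
Qed.

Lemma quotient_special : special Y.
Proof.
split; first exact: quotient_npc.
- move=> e /cross_square [a [b [c [d [s ea ec]]]]].
  have [] := quotient_label_square_neq s.
  by rewrite -(quotient_label_parallel ea) -(quotient_label_parallel ec).
- move=> e /quotient_label_parallel; rewrite quotient_label_rev => /esym.
  exact: label_fixpoint_free adm _.
- by move=> e f /quotient_label_parallel ef nef sef; case: nef; apply: quotient_label_inj.
move=> e1 e2 _ cr f1 f2 ef1 ef2 srcf.
have {cr} /cross_square [a [b [c [d [s fa fc]]]]] : cross f1 f2.
  case/crossP: cr => [a [b [c [d [s h1 h2]]]]]; apply/crossP.
  exists a, b, c, d; split=> //.
    exact: same_hyperplane_trans (same_hyperplane_sym ef1) h1.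
  exact: same_hyperplane_trans (same_hyperplane_sym ef2) h2.
move/quotient_label_parallel: fa => fa; move/quotient_label_parallel: fc => fc.
move: s fa fc => /quotient_square [a' [b' [c' [d' [s <- _ <- _]]]]].
(* Lifts of [f1] and [f2] at one vertex carry the labels of two sides of a square at a corner, so
   (A3) makes them span a square, which projects to the quotient. *)
have [f1' E1] := quotient_map_onto f1; rewrite -E1 -hom_src in srcf.
have [f2' f2src E2] := covering_lift covering_quotient_map (esym srcf).
rewrite -E1 -E2 !quotient_labelE => fa fc.
apply: hom_square_corner; apply: (cat0_square_corner cat0X) => //.
apply/(label_square adm (esym f2src) (src_square s) fa fc); split.
  exact: cat0_sides s.
by apply/crossP; exists a', b', c', d'; split=> //; apply: same_hyperplane_refl.
Qed.

End LabeledQuotient.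

(** * Compactness of the quotient and conclusion *)

Lemma cocompact_quotient (X : cubeset) (Gamma : set (hom X X)) :
  subgroup_of_Aut Gamma -> cocompact Gamma -> compact_complex (quotient Gamma).
Proof.
move=> subG [K finK cover].
pose F (c : {n : nat & X n}) : {n : nat & quotient Gamma n} :=
  existT _ (projT1 c) (quotient_map Gamma _ (projT2 c)).
apply: sub_finite_set (finite_image F finK) => -[n B] _.
have [c <-] := quotient_map_onto B; have [g [d [Gg Kd gd]]] := cover n c.
exists (existT _ n d) => //; congr (existT _ n _) => /=.
by apply/quotient_mapP => //; exists g.
Qed.

Theorem theorem1 :
  (forall (S X : cubeset) (p : hom X S),
     special S -> compact_complex S -> connected S ->
     universal_covering p ->
     has_invariant_admissible_labeling (deck_group p))
  /\
  (forall (X : cubeset) (Gamma : set (hom X X)),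
     cat0 X -> locally_finite X ->
     subgroup_of_Aut Gamma -> cocompact Gamma ->
     has_invariant_admissible_labeling Gamma ->
     special (quotient Gamma) /\
     compact_complex (quotient Gamma) /\
     acts_freely Gamma /\
     universal_covering (quotient_map Gamma)).
Proof.
split=> [S X p specialS compactS _|X Gamma cat0X _ subG cocG].
  exact: special_labeling.
move=> [Sigma0 [inv [l [adm invariant]]]].
split; first exact: quotient_special cat0X subG adm invariant.
split; first exact: cocompact_quotient.
split; first exact: labeled_acts_freely cat0X adm invariant.
by split; [exact: covering_quotient_map cat0X subG adm invariant|case: cat0X].
Qed.
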